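(* Let $X\in\mathbb{R}^{m\times n}$ be a matrix with $\operatorname{rank}(X)=r$, and for $\varepsilon>0$ let $\phi_\varepsilon(X)=\operatorname{tr}\left(X(X^TX+\varepsilon I)^{-1}X^T\right)$. Then for every $\varepsilon>0$, $$\phi_\varepsilon(X)=\sum_{i=1}^r\frac{(\sigma_i(X))^2}{(\sigma_i(X))^2+\varepsilon},$$ where $\sigma_1(X)\ge\cdots\ge\sigma_r(X)>0$ are the (nonzero) singular values of $X$, and the following relation holds for all $\varepsilon>0$: $$0\le \operatorname{rank}(X)-\phi_\varepsilon(X)=\sum_{i=1}^r\frac{\varepsilon}{(\sigma_i(X))^2+\varepsilon}\le \varepsilon\sum_{i=1}^r\frac{1}{(\sigma_i(X))^2}.$$
   Context: $I$ is the $n\times n$ identity matrix and $\operatorname{tr}$ is the trace. Empty sums are zero. *)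

(* Defs.v *)
From HB Require Import structures.
From mathcomp Require Import all_boot all_order all_algebra.
From mathcomp Require Import polyrcf.
From mathcomp Require Export reals.

Set Implicit Arguments.
Unset Strict Implicit.
Unset Printing Implicit Defensive.

Import Order.TTheory GRing.Theory Num.Theory.
Local Open Scope ring_scope.

(* Algebraic multiplicity; [rootsR] lists each real root of the characteristic
   polynomial once, in increasing order. *)
Definition real_eigenvalues (R : rcfType) (n : nat) (A : 'M[R]_n) : seq R :=
  flatten [seq nseq (mup a (char_poly A)) a | a <- rootsR (char_poly A)].

(* All eigenvalues of X^T X are real and nonnegative, so this list has n terms
   and is nonincreasing. When m < n it ends with n - m zeros that are dropped
   in the convention with min(m, n) singular values. *)
Definition singular_values (R : rcfType) (m n : nat) (X : 'M[R]_(m, n)) :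
    seq R :=
  rev [seq Num.sqrt a | a <- real_eigenvalues (X^T *m X)].

(* Indices start at 0: sigma_{i+1}(X) is [singular_value X i]. *)
Definition singular_value (R : rcfType) (m n : nat) (X : 'M[R]_(m, n))
    (i : nat) : R :=
  (singular_values X)`_i.

Definition phi (R : rcfType) (m n : nat) (eps : R) (X : 'M[R]_(m, n)) : R :=
  \tr (X *m invmx (X^T *m X + eps *: 1%:M) *m X^T).

(* [invmx] returns its argument on singular matrices; that case does not occur
   in [phi] when eps > 0. *)
Lemma unitmx_gram_shift (R : rcfType) (m n : nat) (eps : R)
    (X : 'M[R]_(m, n)) :
  0 < eps -> X^T *m X + eps *: 1%:M \in unitmx.
Proof.
move=> eps0; rewrite -row_free_unit; apply/inj_row_free => v vA0.
have sq p (w : 'rV[R]_p) : (w *m w^T) 0 0 = \sum_j w 0 j ^+ 2.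
  by rewrite mxE; apply: eq_bigr => j _; rewrite mxE.
have sq_ge0 p (w : 'rV[R]_p) : 0 <= (w *m w^T) 0 0.
  by rewrite sq sumr_ge0 // => j _; exact: sqr_ge0.
have : (v *m X^T *m (v *m X^T)^T) 0 0 + eps * (v *m v^T) 0 0 = 0.
  have /(congr1 (fun M : 'M[R]_1 => M 0 0)) :
      v *m (X^T *m X + eps *: 1%:M) *m v^T = 0 by rewrite vA0 mul0mx.
  rewrite mulmxDr mulmxDl -scalemxAr mulmx1 -scalemxAl trmx_mul trmxK !mulmxA.
  by rewrite !mxE.
move/eqP; rewrite paddr_eq0 ?sq_ge0 ?mulr_ge0 ?sq_ge0 ?(ltW eps0) //.
case/andP=> _; rewrite mulf_eq0 gt_eqF //= sq.
rewrite psumr_eq0 => [/allP v0 | j _]; last exact: sqr_ge0.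
apply/rowP => j; apply/eqP; rewrite mxE -sqrf_eq0.
exact: v0 (mem_index_enum j).
Qed.

(* Main.v *)
(* The Gram matrix A = X^T X is real symmetric, hence diagonalizable over R as
   P A = D P, and its eigenvalues d_i are nonnegative. The characteristic
   polynomial identifies the d_i with the squared singular values, A has the
   rank of X so exactly rank X of them are nonzero, and cyclicity of the trace
   gives phi_eps(X) = tr (A (A + eps I)^-1) = sum_i d_i / (d_i + eps). *)

Require Import Defs.
From HB Require Import structures.
From mathcomp Require Import all_boot all_order all_algebra.
From mathcomp Require Import reals.
From mathcomp Require Import polyrcf complex.

Import Order.TTheory GRing.Theory Num.Theory.
Local Open Scope ring_scope.

(** * Diagonalization of real symmetric matrices *)

(* The complex spectral theorem provides a complex change of basis; two real
   matrices that are similar over R[i] are similar over R. *)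
Lemma real_symmetric_diagonalization (R : rcfType) (n : nat) (A : 'M[R]_n) :
  A^T = A ->
  exists2 P : 'M[R]_n, P \in unitmx &
    exists d : 'rV[R]_n, P *m A = diag_mx d *m P.
Proof.
move=> symA; pose toC := real_complex R; pose AC := map_mx toC A.
have toC_real m p (M : 'M[R]_(m, p)) : map_mx toC M \is a mxOver Num.real.
  by apply/mxOverP => i j; rewrite mxE complex_real.
have of_real m p (M : 'M[R[i]]_(m, p)) : M \is a mxOver Num.real ->
    exists N : 'M[R]_(m, p), M = map_mx toC N.
  move=> /mxOverP Mreal; exists (map_mx (@complex.Re R) M).
  by apply/matrixP => i j; rewrite !mxE; exact/esym/RRe_real.
have symAC : AC \is symmetricmx.
  by apply/is_hermitianmxP; rewrite expr0 scale1r map_mx_id // /AC map_trmx symA.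
have := orthomx_spectralP (symmetric_normalmx symAC (toC_real _ _ A)).
(* The spectral diagonal is real and so descends to some [d] over [R]; the change of basis [Q] may
   still be complex, and [real_similar] below replaces it by a real one. *)
have := hermitian_spectral_diag_real (realsym_hermsym symAC (toC_real _ _ A)).
have := spectral_unit AC.
move: (spectralmx AC) (spectral_diag AC) => Q D Qu /of_real[d ->] AE.
have [|||P] := @real_similar _ _ AC (diag_mx (map_mx toC d)).
- by exists Q => //; apply/similarP => //; rewrite AE !mulmxA mulmxV ?mul1mx.
- exact: toC_real.
- by rewrite -map_diag_mx toC_real.
rewrite inE => /andP[/of_real[N ->]]; rewrite map_unitmx => Nu.
move=> /similarP; rewrite map_unitmx => /(_ Nu) NA; exists N => //; exists d.
by apply: (@map_mx_inj _ _ toC); rewrite !map_mxM map_diag_mx.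
Qed.

(** * Rank, characteristic polynomial and eigenvalue list *)

Lemma mxrank_diag (F : fieldType) (n : nat) (d : 'rV[F]_n) :
  \rank (diag_mx d) = (\sum_i (d 0 i != 0)%R)%N.
Proof.
elim: n d => [|n IHn] d; first by rewrite big_ord0 flatmx0 mxrank0.
rewrite big_ord_recl; move: d; rewrite -[n.+1]/(1 + n)%N => d.
rewrite -[in LHS](hsubmxK d) diag_mx_row rank_diag_block_mx IHn.
congr (_ + _)%N.
  rewrite [diag_mx _]mx11_scalar rank_rV -scalemx1 scalemx_eq0 oner_eq0 orbF.
  by rewrite !mxE eqxx mulr1n; congr (d _ _ != 0); apply/val_inj.
by apply: eq_bigr => i _; rewrite mxE; congr (d _ _ != 0); apply/val_inj.
Qed.

Lemma char_poly_diagonalization (F : fieldType) (n : nat) (A P : 'M[F]_n)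
    (d : 'rV[F]_n) :
  P \in unitmx -> P *m A = diag_mx d *m P ->
  char_poly A = \prod_(a <- [seq d 0 i | i : 'I_n]) ('X - a%:P).
Proof.
move=> Pu PA; pose PX := map_mx polyC P.
have PXu : \det PX \is a GRing.unit by rewrite det_map_mx rmorph_unit.
transitivity (char_poly (diag_mx d)); last first.
  rewrite char_poly_trig ?diag_mx_is_trig // big_image.
  by apply: eq_bigr => i _; rewrite mxE eqxx.
(* Multiplying both sides by the unit [\det PX] reduces the claim to [P (X - A) = (X - D) P], with
   no inverse of [P]. *)
apply: (mulrI PXu); rewrite [RHS]mulrC -!det_mulmx /char_poly_mx.
by rewrite mulmxBr mulmxBl scalar_mxC -!map_mxM PA.
Qed.

(** For a split polynomial the multiplicity of [a] is its number of occurrences in [s], so both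
    lists consist of the same constant blocks, one per distinct root. *)
Lemma perm_real_eigenvalues (R : rcfType) (n : nat) (A : 'M[R]_n) (s : seq R) :
  char_poly A = \prod_(a <- s) ('X - a%:P) -> perm_eq (real_eigenvalues A) s.
Proof.
move=> cA; have cA0 : char_poly A != 0 by exact/monic_neq0/char_poly_monic.
rewrite -(permPr (perm_count_undup s)); apply/perm_flatten.
under eq_map => a do rewrite cA mu_prod_XsubC.
apply/perm_map/uniq_perm; rewrite ?undup_uniq //.
  exact: lt_sorted_uniq (sorted_roots _ _ _).
by move=> a; rewrite mem_undup -roots_on_rootsR // cA root_prod_XsubC.
Qed.

Lemma le_sorted_real_eigenvalues (R : rcfType) (n : nat) (A : 'M[R]_n) :
  sorted <=%R (real_eigenvalues A).
Proof.
rewrite /real_eigenvalues.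
have := sorted_roots (- cauchy_bound (char_poly A))
  (cauchy_bound (char_poly A)) (char_poly A).
rewrite -/(rootsR _); elim: (rootsR _) => //= a s IHs.
rewrite lt_path_pairwise /= => /andP[/allP lt_a s_lt].
rewrite le_sorted_pairwise pairwise_cat.
rewrite -[pairwise _ (flatten _)]le_sorted_pairwise IHs ?lt_sorted_pairwise //.
rewrite andbT; apply/andP; split.
  apply/allrelP => x y /nseqP[-> _] /flatten_mapP[b bs /nseqP[-> _]].
  exact/ltW/lt_a.
by elim: (mup _ _) => //= k ->; rewrite all_nseq lexx orbT.
Qed.

(** * Gram matrices *)

Lemma sqrmx_gt0 (R : realFieldType) (n : nat) (v : 'rV[R]_n) :
  (0 < (v *m v^T) 0 0) = (v != 0).
Proof.
rewrite lt_def andbC mxE sumr_ge0 /=; last first.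
  by move=> i _; rewrite mxE -expr2 sqr_ge0.
congr (~~ _); apply/idP/eqP => [|->]; last first.
  by rewrite big1 // => i _; rewrite !mxE mul0r.
rewrite psumr_eq0 => [/allP v0|i _]; last by rewrite mxE -expr2 sqr_ge0.
apply/rowP => i; apply/eqP; rewrite mxE -sqrf_eq0 expr2.
by have := v0 i (mem_index_enum i); rewrite mxE.
Qed.

(** If [v X^T X = 0], then [v X^T] has squared norm 0 and vanishes; hence the left kernel of [X^T X]
    lies in that of [X^T]. *)
Lemma mxrank_gram (R : realFieldType) (m n : nat) (X : 'M[R]_(m, n)) :
  \rank (X^T *m X) = \rank X.
Proof.
apply/eqP; rewrite eqn_leq mxrankM_maxr /= -[leqLHS](mxrank_tr X).
rewrite -(leq_sub2lE _ (rank_leq_row _)) -!mxrank_ker; apply/mxrankS/rV_subP => v.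
move=> /sub_kermxP; rewrite mulmxA => vXX; apply/sub_kermxP/eqP.
by rewrite -[_ == 0]negbK -sqrmx_gt0 trmx_mul trmxK mulmxA vXX mul0mx mxE ltxx.
Qed.

(** An eigenvector [v] gives [|v X^T|^2 = a |v|^2] with [|v|^2 > 0]. *)
Lemma root_char_poly_gram_ge0 (R : realFieldType) (m n : nat)
    (X : 'M[R]_(m, n)) (a : R) :
  root (char_poly (X^T *m X)) a -> 0 <= a.
Proof.
rewrite -eigenvalue_root_char => /eigenvalueP[v va v0].
have : 0 <= (v *m X^T *m (v *m X^T)^T) 0 0.
  by rewrite mxE sumr_ge0 // => i _; rewrite [X in _ * X]mxE -expr2 sqr_ge0.
rewrite trmx_mul trmxK -mulmxA [X^T *m _]mulmxA mulmxA va -scalemxAl mxE.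
by rewrite pmulr_lge0 // sqrmx_gt0.
Qed.

(** [P] intertwines [A] with the diagonal matrix [D], hence also [A + e I] with [D + e I], and their
    inverses. *)
Lemma mxtrace_resolvent_diagonalization (F : fieldType) (n : nat)
    (A P : 'M[F]_n) (d : 'rV[F]_n) (e : F) :
  P \in unitmx -> P *m A = diag_mx d *m P -> A + e *: 1%:M \in unitmx ->
  \tr (A *m invmx (A + e *: 1%:M)) = \sum_i d 0 i / (d 0 i + e).
Proof.
move=> Pu PA; pose f := \row_i (d 0 i + e).
have PAe : P *m (A + e *: 1%:M) = diag_mx f *m P.
  rewrite mulmxDr PA -scalemxAr mulmx1 -mul_scalar_mx -mulmxDl; congr (_ *m _).
  by apply/matrixP => i j; rewrite !mxE mulrnDl.
move=> Aeu; have fu : diag_mx f \in unitmx.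
  by have := unitmx_mul P (A + e *: 1%:M); rewrite PAe Pu Aeu unitmx_mul Pu andbT.
(* Invertibility of [A + e I] passes to [diag_mx f], whose determinant is the product of the
   [d_i + e]. *)
have f0 i : f 0 i != 0.
  move: fu; rewrite unitmxE det_diag unitfE prodf_seq_neq0 => /allP/(_ i).
  by rewrite mem_index_enum => /(_ isT).
have PAV : P *m invmx (A + e *: 1%:M) = diag_mx (\row_i (f 0 i)^-1) *m P.
  rewrite -[P in RHS](mulmxK Aeu) PAe !mulmxA mulmx_diag.
  rewrite (_ : diag_mx _ = 1%:M) ?mul1mx //.
  by apply/matrixP => i j; rewrite !mxE mulVf //; have := f0 i; rewrite mxE.
move: (invmx (A + _)) PAV => B PAV.
(* Insert [P^-1 P] in front and cycle [P^-1] to the end, so that [P] can be pushed through both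
   factors. *)
rewrite -[A *m _]mul1mx -(mulVmx Pu) -mulmxA mxtrace_mulC mulmxA PA.
rewrite -[diag_mx d *m P *m _]mulmxA PAV mulmxA mulmxK // mulmx_diag mxtrace_diag.
by apply: eq_bigr => i _; rewrite !mxE.
Qed.

(** The positive entries form a prefix; past the end the default value 0 makes both sides false. *)
Lemma sorted_ge_nth_gt0 (R : realDomainType) (s : seq R) (i : nat) :
  sorted >=%R s -> all (>= 0) s -> (0 < s`_i) = (i < count (> 0)%R s)%N.
Proof.
elim: s i => [|x s IHs] i /=; first by rewrite nth_nil ltxx.
rewrite (path_sortedE ge_trans) => /andP[/allP x_max s_sorted].
case/andP=> x_ge0 s_ge0; case: (ltP 0 x) => [x_gt0|x_le0].
  by case: i => [|i] /=; rewrite ?x_gt0 // add1n ltnS IHs.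
have s_le0 y : y \in s -> (0 < y) = false.
  by move=> /x_max /= yx; apply/negbTE; rewrite -leNgt (le_trans yx).
rewrite (eq_in_count s_le0) count_pred0 ltn0.
case: i => [|i] /=; first by rewrite ltNge x_le0.
have [i_lt|i_ge] := ltnP i (size s); first by rewrite s_le0 ?mem_nth.
by rewrite nth_default ?ltxx.
Qed.

(** * Singular values, rank and trace *)

Section SingularValues.
Context {R : rcfType} {m n : nat} (X : 'M[R]_(m, n)).

Lemma real_eigenvalues_gram_ge0 : all (>= 0) (real_eigenvalues (X^T *m X)).
Proof.
apply/allP => a /flatten_mapP[b + /nseqP[-> _]].
rewrite -roots_on_rootsR ?monic_neq0 ?char_poly_monic // => /andP[_].
exact: root_char_poly_gram_ge0.
Qed.

Lemma singular_values_ge0 : all (>= 0) (singular_values X).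
Proof. by rewrite all_rev all_map; apply/allP => a _; exact: sqrtr_ge0. Qed.

Lemma ge_sorted_singular_values : sorted >=%R (singular_values X).
Proof.
rewrite rev_sorted sorted_map; have := le_sorted_real_eigenvalues _ _ (X^T *m X).
by apply: sub_sorted => a b; exact: ler_wsqrtr.
Qed.

Lemma gram_diagonalization : exists2 P : 'M[R]_n, P \in unitmx &
  exists2 d : 'rV[R]_n, P *m (X^T *m X) = diag_mx d *m P &
    perm_eq (real_eigenvalues (X^T *m X)) [seq d 0 i | i : 'I_n].
Proof.
have [|P Pu [d Pd]] := real_symmetric_diagonalization _ _ (X^T *m X).
  by rewrite trmx_mul trmxK.
exists P => //; exists d => //; apply/perm_real_eigenvalues.
exact: char_poly_diagonalization Pu Pd.
Qed.

Lemma count_singular_values_gt0 : count (> 0) (singular_values X) = \rank X.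
Proof.
have [P Pu [d Pd /permP eig]] := gram_diagonalization.
have -> : \rank X = \rank (diag_mx d).
  have Pfull : row_full P by rewrite row_full_unit.
  rewrite -mxrank_gram -(eqmxMfull (X^T *m X) Pfull) Pd.
  by rewrite mxrankMfree // row_free_unit.
rewrite mxrank_diag count_rev count_map.
(* Since eigenvalues are nonnegative, a square root is positive exactly when the eigenvalue is
   nonzero. *)
transitivity (count (predC1 0) (real_eigenvalues (X^T *m X))).
  apply: eq_in_count => a /(allP real_eigenvalues_gram_ge0) /= a_ge0.
  by rewrite sqrtr_gt0 lt_def a_ge0 andbT.
rewrite eig -sum1_count big_image_cond big_mkcond.
by apply: eq_bigr => i _ /=; case: (_ == _).
Qed.

(** Here the sum still includes the zero singular values; [big_singular_values] cuts it down to the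
    rank. *)
Lemma phi_singular_values (eps : R) : 0 < eps ->
  phi eps X = \sum_(s <- singular_values X) s ^+ 2 / (s ^+ 2 + eps).
Proof.
move=> eps0; have [P Pu [d Pd eig]] := gram_diagonalization.
rewrite /phi mxtrace_mulC mulmxA.
rewrite (mxtrace_resolvent_diagonalization _ _ _ _ _ _ Pu Pd) ?unitmx_gram_shift //.
rewrite (perm_big _ (permEl (perm_rev _))) big_map.
transitivity (\sum_(a <- real_eigenvalues (X^T *m X)) a / (a + eps)).
  by rewrite (perm_big _ eig) big_image.
apply: eq_big_seq => a a_in; rewrite sqr_sqrtr //.
exact: (allP real_eigenvalues_gram_ge0).
Qed.

Lemma singular_value_gt0 (i : nat) :
  (0 < singular_value X i) = (i < \rank X)%N.
Proof.
rewrite sorted_ge_nth_gt0 ?count_singular_values_gt0 //.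
  exact: ge_sorted_singular_values.
exact: singular_values_ge0.
Qed.

Lemma singular_value_ge0 (i : nat) : 0 <= singular_value X i.
Proof.
have [i_lt|i_ge] := ltnP i (size (singular_values X)).
  exact/(allP singular_values_ge0)/mem_nth.
by rewrite /singular_value nth_default.
Qed.

Lemma singular_value_eq0 (i : nat) :
  (\rank X <= i)%N -> singular_value X i = 0.
Proof.
rewrite leqNgt -singular_value_gt0 lt_def singular_value_ge0 andbT negbK.
by move/eqP.
Qed.

Lemma big_singular_values (f : R -> R) : f 0 = 0 ->
  \sum_(s <- singular_values X) f s = \sum_(i < \rank X) f (singular_value X i).
Proof.
move=> f0; rewrite (big_nth 0) -(big_mkord xpredT (f \o singular_value X)).
have rk_le : (\rank X <= size (singular_values X))%N.
  by rewrite -count_singular_values_gt0 count_size.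
rewrite (big_cat_nat (leq0n _) rk_le) //= [X in _ + X]big_nat_cond.
rewrite [X in _ + X]big1 ?addr0 // => i /andP[/andP[/singular_value_eq0 s0 _] _].
by rewrite -/(singular_value X i) s0.
Qed.

Lemma singular_value_nonincreasing (i j : nat) :
  (i <= j)%N -> singular_value X j <= singular_value X i.
Proof.
move=> ij; have [j_lt|j_ge] := ltnP j (size (singular_values X)).
  apply: (sorted_leq_nth ge_trans lexx 0 ge_sorted_singular_values) => //.
  exact: leq_ltn_trans j_lt.
(* Past the end of the list [singular_value X j] is the default 0. *)
by rewrite [leLHS]nth_default ?singular_value_ge0.
Qed.

End SingularValues.

(** * Trace formula and bounds on the rank defect *)

Theorem theorem2p1 (R : realType) (m n r : nat) (X : 'M[R]_(m, n))
    (hr : \rank X = r) :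
  [/\ forall i j : nat, (i <= j < r)%N ->
        singular_value X j <= singular_value X i,
      forall i : nat, (i < r)%N -> 0 < singular_value X i
    & forall i : nat, (r <= i)%N -> singular_value X i = 0] /\
  (forall eps : R, 0 < eps ->
    [/\ phi eps X =
          \sum_(i < r) singular_value X i ^+ 2 /
                       (singular_value X i ^+ 2 + eps),
        0 <= (\rank X)%:R - phi eps X,
        (\rank X)%:R - phi eps X =
          \sum_(i < r) eps / (singular_value X i ^+ 2 + eps)
      & \sum_(i < r) eps / (singular_value X i ^+ 2 + eps) <=
          eps * \sum_(i < r) (1 / singular_value X i ^+ 2)]).
Proof.
split; first split.
- by move=> i j /andP[ij _]; exact: singular_value_nonincreasing.
- by move=> i; rewrite singular_value_gt0 hr.
- by move=> i; rewrite -hr; exact: singular_value_eq0.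
move=> eps eps0; have denom_gt0 i : 0 < singular_value X i ^+ 2 + eps.
  by rewrite ltr_wpDl ?sqr_ge0.
have phiE : phi eps X =
    \sum_(i < r) singular_value X i ^+ 2 / (singular_value X i ^+ 2 + eps).
  rewrite phi_singular_values // -hr.
  rewrite (big_singular_values X (fun s => s ^+ 2 / (s ^+ 2 + eps))) //.
  by rewrite expr0n mul0r.
have defectE : (\rank X)%:R - phi eps X =
    \sum_(i < r) eps / (singular_value X i ^+ 2 + eps).
  (* The rank is a sum of [r] ones, each written as [(s^2 + eps) / (s^2 + eps)] before
     subtracting. *)
  rewrite phiE hr -[X in X%:R]card_ord -sumr_const -sumrB.
  apply: eq_bigr => i _; rewrite -[X in X - _](divff (lt0r_neq0 (denom_gt0 i))).
  by rewrite -mulrBl addrC addKr.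
split=> //.
  by rewrite defectE sumr_ge0 // => i _; rewrite divr_ge0 ?ltW.
(* The bound holds term by term, as [0 < s^2 <= s^2 + eps] for every index below the rank. *)
rewrite mulr_sumr ler_sum // => i _; rewrite mul1r ler_wpM2l ?(ltW eps0) //.
rewrite lef_pV2 ?posrE ?denom_gt0 // ?exprn_gt0 ?singular_value_gt0 ?hr //.
by rewrite lerDl ltW.
Qed.
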